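(* Let $k,\ell\ge 1$ and $n$ be integers with $k+\ell\le n$. Suppose that $\emptyset\ne\mathcal B\subset\mathcal A(n,k)$ and $\emptyset\neq\mathcal C\subset\mathcal A(n,\ell)$ are cross-intersecting. Then $$|\mathcal B|+|\mathcal C|\le k+\ell .$$ Moreover, for $k+\ell<n$, equality implies that $\lambda(\mathcal B)=\lambda(\mathcal C)=1$.
   Context: Fix a permutation $(x_1,\dots,x_n)$ of $[n]=\{1,\dots,n\}$, viewed cyclically (indices modulo $n$). For $1\le k<n$ and $1\le r\le n$ the arc $A_k(r)$ is the $k$-set $\{x_r,x_{r+1},\dots,x_{r+k-1}\}$, and $\mathcal A(n,k)=\{A_k(r):1\le r\le n\}$ is the family of all $n$ arcs of length $k$. Two families $\mathcal F,\mathcal G$ are cross-intersecting if $F\cap G\ne\emptyset$ for all $F\in\mathcal F$, $G\in\mathcal G$. For $\mathcal B\subset\mathcal A(n,k)$, let $G(\mathcal A(n,k))$ be the $n$-cycle on vertex set $\mathcal A(n,k)$ in which $A_k(r)$ and $A_k(r+1)$ are joined by an edge for every $r$ modulo $n$, and let $G(\mathcal B)$ be the induced subgraph on $\mathcal B$. Then $\lambda(\mathcal B)$ denotes the number of (nonempty) connected components of $G(\mathcal B)$. *)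

(* Defs.v *)
From mathcomp Require Import all_boot all_order all_fingroup.

Set Implicit Arguments.
Unset Strict Implicit.
Unset Printing Implicit Defensive.

(* The ground set [n] and the index set Z/n are both encoded as 'I_n, with
   [ordS] as the cyclic successor on indices; the permutation (x_1, ..., x_n)
   is x : 'S_n. *)
Definition arc (n : nat) (x : 'S_n) (k : nat) (r : 'I_n) : {set 'I_n} :=
  [set x (iter i (@ordS n) r) | i : 'I_k].

Definition arcs (n : nat) (x : 'S_n) (k : nat) : {set {set 'I_n}} :=
  [set arc x k r | r : 'I_n].

Definition cross_intersecting (T : finType) (F G : {set {set T}}) : Prop :=
  forall A B : {set T}, A \in F -> B \in G -> A :&: B != set0.

Definition arc_adj (n : nat) (x : 'S_n) (k : nat) : rel {set 'I_n} :=
  fun A B => [exists r : 'I_n,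
    ((A == arc x k r) && (B == arc x k (ordS r))) ||
    ((B == arc x k r) && (A == arc x k (ordS r)))].

Definition induced (T : finType) (e : rel T) (V : {set T}) : rel T :=
  fun u v => [&& u \in V, v \in V & e u v].

(* [n_comp] only has its intended meaning for a symmetric [connect] and a closed
   vertex set; see [induced_arc_adj_sym] and [induced_closed]. *)
Definition lambda (n : nat) (x : 'S_n) (k : nat) (B : {set {set 'I_n}}) : nat :=
  n_comp (induced (arc_adj x k) B) B.

Lemma induced_arc_adj_sym (n : nat) (x : 'S_n) (k : nat)
    (B : {set {set 'I_n}}) : connect_sym (induced (arc_adj x k) B).
Proof.
apply: sym_connect_sym => u v; rewrite /induced andbCA.
by congr [&& _, _ & _]; apply: eq_existsb => r; rewrite orbC.
Qed.

Lemma induced_closed (T : finType) (e : rel T) (V : {set T}) :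
  closed (induced e V) V.
Proof. by move=> u v /and3P[-> ->]. Qed.

(* Main.v *)
Require Import Defs.
From mathcomp Require Import all_boot all_order all_fingroup.
From mathcomp Require Import zify.

(* The sequence library also has an [arc], a sub-arc of a cyclic sequence. *)
Local Notation arc := Defs.arc.

(** Replace the two families by their index sets S and T in Z/n.  The arcs of
    length k at r and of length l at s are disjoint exactly when s - r lies in
    the interval [k, n - l], so with m = n - k - l the cross-intersecting
    hypothesis says that T avoids the translate by k of S + [0, m].

    Adding the interval [0, 1] to a set S enlarges it by one element for each
    maximal run of consecutive indices, that is, for each r in S whose successor
    is not in S (an exit of S).  A set that is neither empty nor all of Z/n has
    an exit, because the successor acts transitively.  Since T is nonempty,
    S + [0, m] is not all of Z/n, so each of the m enlargements gains at least
    one element ([card_iter_spread]), whence |S| + m <= n - |T|, which is the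
    bound.  If m > 0 and equality holds, the first enlargement gained exactly
    one element, so S has exactly one exit ([cross_arcs_index]); walking forward
    from any index of S one stays in S until that exit, so the arcs of the
    family form a single component ([lambda_single_exit]).  The argument for T
    is the same with the roles exchanged. *)

Definition exits {n : nat} (S : {set 'I_n}) : {set 'I_n} :=
  [set r in S | ordS r \notin S].

Definition spread {n : nat} (S : {set 'I_n}) : {set 'I_n} :=
  S :|: [set ordS r | r in S].

Lemma val_iter_ordS (n i : nat) (r : 'I_n) :
  iter i (@ordS n) r = (r + i) %% n :> nat.
Proof.
elim: i => [|i IHi] /=; first by rewrite addn0 modn_small.
by rewrite IHi -addn1 modnDml addn1 addnS.
Qed.

Lemma iter_ordS_inj {n : nat} (i : nat) : injective (iter i (@ordS n)).
Proof. by elim: i => [|i IHi] r s //= /ordS_inj /IHi. Qed.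

Lemma iter_ordS_eq (n i j : nat) (r : 'I_n) :
  i < n -> j < n -> iter i (@ordS n) r = iter j (@ordS n) r -> i = j.
Proof.
move=> ltin ltjn /(congr1 val) /eqP; rewrite /= !val_iter_ordS eqn_modDl.
by rewrite !modn_small // => /eqP.
Qed.

(** A set without exits is stable under the transitive action of [ordS]. *)
Lemma exits_neq0 {n : nat} (S : {set 'I_n}) :
  S != set0 -> S != setT -> exits S != set0.
Proof.
case/set0Pn=> r Sr; apply: contraNneq => exits0.
have closedS i : iter i (@ordS n) r \in S.
  elim: i => //= i IHi; apply: contraT => notSi.
  by have := in_set0 (iter i (@ordS n) r); rewrite -exits0 inE IHi notSi.
apply/eqP/setP=> s; rewrite inE.
suff -> : s = iter (n - r + s) (@ordS n) r by rewrite closedS.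
apply: val_inj; rewrite /= val_iter_ordS addnA subnKC ?modnDl ?modn_small //.
exact: ltnW.
Qed.

Lemma card_spread (n : nat) (S : {set 'I_n}) :
  #|spread S| = #|S| + #|exits S|.
Proof.
have -> : spread S = S :|: [set ordS r | r in exits S].
  apply/setP=> s; rewrite !inE; case: (boolP (s \in S)) => //= notSs.
  apply/imsetP/imsetP=> -[r Sr Ds]; exists r => //.
    by rewrite inE Sr -Ds.
  by move: Sr; rewrite inE => /andP[].
rewrite cardsU (card_imset _ (@ordS_inj n)) [_ :&: _](_ : _ = set0).
  by rewrite cards0 subn0.
apply/setP=> s; rewrite !inE; apply/negP=> /andP[Ss /imsetP[r]].
by rewrite inE => /andP[_ /negPf notSr] Ds; rewrite Ds notSr in Ss.
Qed.

Lemma sub_iter_spread (n m : nat) (S : {set 'I_n}) :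
  S \subset iter m spread S.
Proof.
by elim: m => //= m IHm; apply: (subset_trans IHm); apply: subsetUl.
Qed.

Lemma iter_spreadP (n m : nat) (S : {set 'I_n}) (s : 'I_n) :
  s \in iter m spread S ->
  exists r i, [/\ r \in S, i <= m & s = iter i (@ordS n) r].
Proof.
elim: m s => [|m IHm] s /=; first by exists s, 0.
rewrite inE => /orP[/IHm|/imsetP[t /IHm]] [r [i [Sr leim ->]]].
  by exists r, i; split=> //; apply: leqW.
by move=> ->; exists r, i.+1.
Qed.

Lemma iter_spread_neqT (n m : nat) (S : {set 'I_n}) :
  iter m spread S != setT -> S != setT.
Proof.
by apply: contra_neq => DS; apply/eqP; rewrite -subTset -{1}DS sub_iter_spread.
Qed.

Lemma card_iter_spread (n m : nat) (S : {set 'I_n}) :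
  S != set0 -> iter m spread S != setT ->
  #|S| + m <= #|iter m spread S|.
Proof.
elim: m S => [|m IHm] S S0 ST; first by rewrite addn0.
have := exits_neq0 S S0 (iter_spread_neqT _ _ _ ST).
rewrite iterSr in ST *; rewrite -card_gt0 => exits_gt0.
have spread0 : spread S != set0.
  by rewrite -card_gt0 card_spread addn_gt0 card_gt0 S0.
by have := IHm _ spread0 ST; rewrite card_spread; lia.
Qed.

(** Read from r, the two arcs occupy the offsets [0, k) and [i + k, i + k + l);
    these do not wrap around, so they stay disjoint modulo n. *)
Lemma disjoint_arcs (n k l i : nat) (x : 'S_n) (r : 'I_n) :
  i + k + l <= n -> arc x k r :&: arc x l (iter (i + k) (@ordS n) r) = set0.
Proof.
move=> le_n; apply/setP=> y; rewrite !inE; apply/negP.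
case/andP=> /imsetP[a _ ->] /imsetP[b _ /perm_inj].
rewrite -iterD; have ltak := ltn_ord a; have ltbl := ltn_ord b.
by move/iter_ordS_eq; lia.
Qed.

(** The index form of the bound.  Its equality case is stated for S only, since
    the hypotheses are symmetric in (S, k) and (T, l). *)
Lemma cross_arcs_index (n k l : nat) (x : 'S_n) (S T : {set 'I_n}) :
  k + l <= n -> S != set0 -> T != set0 ->
  (forall r s, r \in S -> s \in T -> arc x k r :&: arc x l s != set0) ->
  #|S| + #|T| <= k + l /\
  (k + l < n -> #|S| + #|T| = k + l -> #|exits S| = 1).
Proof.
move=> le_kl_n S0 T0 crossST; pose m := n - (k + l).
have card_spreadT : #|iter m spread S| + #|T| <= n.
  (* T misses the translate V by k of S + [0, m]. *)
  rewrite -(card_imset _ (iter_ordS_inj k)); set V := imset _ _.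
  apply: (@leq_trans (#|V| + #|~: V|)); last by rewrite cardsC card_ord.
  rewrite leq_add2l; apply: subset_leq_card.
  apply/subsetP=> s Ts.
  rewrite inE; apply/negP=> /imsetP[_ /iter_spreadP[r [i [Sr leim ->]]] Ds].
  have := crossST _ _ Sr Ts; rewrite Ds -iterD addnC disjoint_arcs ?eqxx //.
  by rewrite /m in leim; lia.
have T_gt0 : 0 < #|T| by rewrite card_gt0.
have spreadT : iter m spread S != setT.
  by apply: contraTneq card_spreadT => ->; rewrite cardsT card_ord; lia.
have := card_iter_spread _ _ _ S0 spreadT.
have exits_gt0 : 0 < #|exits S|.
  by rewrite card_gt0 exits_neq0 // (iter_spread_neqT _ _ _ spreadT).
rewrite /m in spreadT card_spreadT * => bound; split=> [|lt_kl_n]; first by lia.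
(* Splitting off the first enlargement exposes its exact gain. *)
case Dm: (n - (k + l)) spreadT card_spreadT => [|m']; first by lia.
rewrite iterSr => spreadT card_spreadT.
have spread0 : spread S != set0.
  by rewrite -card_gt0 card_spread addn_gt0 card_gt0 S0.
by have := card_iter_spread _ _ _ spread0 spreadT; rewrite card_spread; lia.
Qed.

(** An index of S whose arc is not linked to the arc at the exit e would lie in
    a nonempty proper subset of Z/n, which has an exit of its own; as adjacent
    arcs of the family are linked, that exit would be a second exit of S. *)
Lemma lambda_single_exit (n k : nat) (x : 'S_n) (S : {set 'I_n}) :
  #|exits S| = 1 -> lambda x k [set arc x k r | r in S] = 1.
Proof.
move=> /eqP/cards1P[e De]; set B := [set _ | r in S].
have Se : e \in S by have := set11 e; rewrite -De inE => /andP[].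
pose linked r := connect (induced (arc_adj x k) B) (arc x k r) (arc x k e).
have linkedS r : r \in S -> linked r.
  pose S' := [set r in S | ~~ linked r] => Sr; apply: contraT => unlinked_r.
  have S'0 : S' != set0 by apply/set0Pn; exists r; rewrite inE Sr.
  have S'T : S' != setT.
    by apply/eqP=> /setP/(_ e); rewrite !inE /linked connect0 andbF.
  have /set0Pn[t] := exits_neq0 _ S'0 S'T.
  rewrite !inE => /andP[/andP[St unlinked_t]].
  case: (boolP (ordS t \in S)) => [St1 | notSt1 _] /=.
    rewrite negbK => link; case/negP: unlinked_t.
    apply: connect_trans link; apply: connect1.
    rewrite /induced !imset_f //=; apply/existsP; exists t.
    by rewrite !eqxx.
  have : t \in exits S by rewrite inE St.
  by rewrite De => /set1P Dt; rewrite Dt /linked connect0 in unlinked_t.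
have symB := induced_arc_adj_sym x k B.
rewrite /lambda -(n_comp_connect symB (arc x k e)); apply: eq_n_comp_r => A.
rewrite [RHS]inE; apply/idP/idP=> [/imsetP[r Sr ->]|link].
  by rewrite symB; apply: linkedS.
by rewrite -(closed_connect (@induced_closed _ _ B) link) imset_f.
Qed.

Lemma arcs_indexed (n k : nat) (x : 'S_n) (B : {set {set 'I_n}}) :
  B \subset arcs x k -> B = [set arc x k r | r in arc x k @^-1: B].
Proof.
move/subsetP=> sub; apply/setP=> A; apply/idP/imsetP=> [BA|[r]].
  by have /imsetP[r _ DA] := sub A BA; exists r; rewrite // inE -DA.
by rewrite inE => BA ->.
Qed.

Theorem theorem3p4 (n k l : nat) (x : 'S_n) (B C : {set {set 'I_n}}) :
  1 <= k -> 1 <= l -> k + l <= n ->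
  B != set0 -> B \subset arcs x k ->
  C != set0 -> C \subset arcs x l ->
  cross_intersecting B C ->
  #|B| + #|C| <= k + l /\
  (k + l < n -> #|B| + #|C| = k + l -> lambda x k B = 1 /\ lambda x l C = 1).
Proof.
move=> _ _ le_kl_n B0 /arcs_indexed DB C0 /arcs_indexed DC crossBC.
set S := arc x k @^-1: B in DB; set T := arc x l @^-1: C in DC.
have S0 : S != set0 by apply: contraNneq B0 => S0; rewrite DB S0 imset0.
have T0 : T != set0 by apply: contraNneq C0 => T0; rewrite DC T0 imset0.
have crossST r s : r \in S -> s \in T -> arc x k r :&: arc x l s != set0.
  by rewrite !inE; apply: crossBC.
have crossTS s r : s \in T -> r \in S -> arc x l s :&: arc x k r != set0.
  by rewrite setIC => Ts Sr; apply: crossST.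
have [boundST exitS] := cross_arcs_index _ _ _ _ _ _ le_kl_n S0 T0 crossST.
have le_lk_n : l + k <= n by rewrite addnC.
have [_ exitT] := cross_arcs_index _ _ _ _ _ _ le_lk_n T0 S0 crossTS.
have le_card : #|B| + #|C| <= #|S| + #|T|.
  by rewrite {1}DB {1}DC leq_add ?leq_imset_card.
split=> [|lt_kl_n eqBC]; first exact: leq_trans boundST.
have eqST : #|S| + #|T| = k + l.
  by apply/eqP; rewrite eqn_leq boundST -eqBC le_card.
rewrite DB DC; split; apply: lambda_single_exit; first exact: exitS.
by apply: exitT; rewrite addnC // eqST addnC.
Qed.
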